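(* Let $\mathcal G=(U,\mathcal A)$ be the multi-hypergraph of a conjunction $\bigwedge_{S\in\mathcal A}\mathrm{NAE}(\mathbf X_S)$, let $N$ be an upper bound on the domain sizes of the variables $(X_i)_{i\in U}$, and let $c$ be a positive integer. Suppose there exists a family $\mathcal F$ of functions $f:[N]\to[c]$ such that for every proper $N$-coloring $h:U\to[N]$ of $\mathcal G$ there exists $f\in\mathcal F$ such that $f\circ h$ is a proper $c$-coloring of $\mathcal G$. Then $$\bigwedge_{S\in\mathcal A}\mathrm{NAE}(\mathbf X_S)\ \equiv\ \bigvee_{g}\ \bigvee_{f\in\mathcal F}\ \bigwedge_{i\in U}\bigl(f(X_i)=g(i)\bigr),$$ where $g$ ranges over all proper $c$-colorings of $\mathcal G$. In particular, the Boolean tensor rank of $\bigwedge_{S\in\mathcal A}\mathrm{NAE}(\mathbf X_S)$ is at most $P(\mathcal G,c)\cdot|\mathcal F|$.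
   Context: $[n]=\{1,\dots,n\}$. The domains of all variables $X_i$, $i\in U$, are identified with subsets of the common set $[N]$. $\mathbf X_S=(X_i)_{i\in S}$; the predicate $\mathrm{NAE}(\mathbf X_S)$ (not-all-equal, $|S|\ge 2$) holds iff not all variables in $\mathbf X_S$ have the same value. The multi-hypergraph of the conjunction has the variable indices $U$ as vertices and the sets $S\in\mathcal A$ (with multiplicity) as hyperedges. A proper $c$-coloring of $\mathcal G=(U,\mathcal A)$ is a map $h:U\to[c]$ such that every $S\in\mathcal A$ contains $u\ne v$ with $h(u)\ne h(v)$. $P(\mathcal G,c)$ is the number of proper $c$-colorings of $\mathcal G$. The Boolean tensor rank of a Boolean function $\varphi$ of the variables $(X_i)_{i\in U}$ is the smallest $r$ such that $\varphi\equiv\bigvee_{j\in[r]}\bigwedge_{i\in U}f_i^{(j)}(X_i)$ for some univariate Boolean functions $f_i^{(j)}$. *)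

(* Defs.v *)
From mathcomp Require Import all_boot.

Set Implicit Arguments.
Unset Strict Implicit.
Unset Printing Implicit Defensive.

Section BooleanTensorRank.

Variables (U : finType) (T : U -> finType).

(* Assignments are finite functions, so that a Boolean function [phi] of the
   variables is automatically invariant under pointwise equality. *)
Definition assignment := {dffun forall i : U, T i}.

Implicit Type phi : assignment -> bool.

Definition has_tensor_decomp phi (r : nat) : bool :=
  [exists f : {ffun 'I_r -> {dffun forall i : U, {ffun T i -> bool}}},
     [forall x : assignment,
        phi x == [exists j : 'I_r, [forall i : U, f j i (x i)]]]].

Lemma has_tensor_decomp_ex phi : exists r, has_tensor_decomp phi r.
Proof.
exists #|phi|; apply/existsP.
exists [ffun j : 'I_#|phi| =>
  ([ffun i => [ffun v => v == (enum_val j : assignment) i]]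
     : {dffun forall i : U, {ffun T i -> bool}})].
apply/forallP => x; apply/eqP; apply/idP/existsP => [px | [j /forallP fx]].
  have xp : x \in phi by [].
  exists (enum_rank_in xp x); apply/forallP => i.
  by rewrite !ffunE enum_rankK_in.
have -> : x = enum_val j by apply/ffunP => i; have := fx i; rewrite !ffunE => /eqP.
exact: (enum_valP j).
Qed.

Definition boolean_tensor_rank phi : nat := ex_minn (has_tensor_decomp_ex phi).

End BooleanTensorRank.

Section Hypergraph.

(* A multi-hypergraph on the vertex set [U] is given by the sequence [A] of its
   hyperedges, so that multiplicities are recorded. *)
Variable U : finType.
Implicit Types (A : seq {set U}) (S : {set U}).

Definition NAE (V : eqType) (x : U -> V) S : bool :=
  ~~ [forall i in S, forall j in S, x i == x j].

Definition NAE_conj (V : eqType) A (x : U -> V) : bool := all (NAE x) A.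

Definition proper_coloring c A (h : {ffun U -> 'I_c}) : bool :=
  all (fun S => [exists u in S, exists v in S, (u != v) && (h u != h v)]) A.

Definition num_proper_colorings A c : nat :=
  #|[set h : {ffun U -> 'I_c} | proper_coloring A h]|.

End Hypergraph.

Section Domains.

Variables (U : finType) (N : nat) (D : U -> {set 'I_N}).

Definition domain (i : U) : finType := {v : 'I_N | v \in D i}.

Definition values (x : assignment domain) (i : U) : 'I_N := val (x i).

End Domains.

(* Main.v *)
Require Import Defs.
From mathcomp Require Import all_boot.

(** A coloring of the vertices is proper exactly when it satisfies the
    conjunction of the not-all-equal predicates.  So a satisfying assignment [x]
    is a proper [N]-coloring, and some [f] in [F] makes [g := f \o x] proper;
    conversely, if [f \o x] is proper then so is [x].  Each pair [(g, f)]
    contributes one rank-one term, whence the bound on the tensor rank. *)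

(** Enumerating [J] by [enum_val] turns a disjunction over any finite set into one over ['I_#|J|],
    and the rank is the least possible number of terms. *)
Lemma boolean_tensor_rank_le_card (U : finType) (T : U -> finType)
    (phi : assignment T -> bool) (K : finType) (J : {set K})
    (f : K -> forall i, T i -> bool) :
    (forall x : assignment T,
       phi x = [exists j in J, [forall i, f j i (x i)]]) ->
  boolean_tensor_rank phi <= #|J|.
Proof.
move=> phiE; rewrite /boolean_tensor_rank; case: ex_minnP => m _; apply.
apply/existsP; exists [ffun k : 'I_#|J| =>
  ([ffun i => [ffun v => f (enum_val k) i v]]
     : {dffun forall i : U, {ffun T i -> bool}})].
apply/forallP => x; rewrite phiE; apply/eqP; apply/idP/idP.
- case/existsP => j /andP[Jj /forallP fj]; apply/existsP.
  exists (enum_rank_in Jj j); apply/forallP => i.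
  by rewrite !ffunE enum_rankK_in.
- case/existsP => k /forallP fk; apply/existsP; exists (enum_val k).
  rewrite enum_valP; apply/forallP => i.
  by have := fk i; rewrite !ffunE.
Qed.

(** After pushing negations inward, the sides differ only by the conjunct [u != v], which
    [h u != h v] implies. *)
Lemma proper_coloringE (U : finType) (A : seq {set U}) (c : nat)
    (h : {ffun U -> 'I_c}) :
  proper_coloring A h = NAE_conj A h.
Proof.
apply: eq_all => S; rewrite /NAE negb_forall_in.
apply: eq_existsb => u; rewrite negb_forall_in; congr (_ && _).
apply: eq_existsb => v; congr (_ && _).
by case: eqVneq => [->|_] //; rewrite eqxx.
Qed.

(** Stands in for functional extensionality when passing between [x] and [finfun x], or between [g]
    and [f \o x]. *)
Lemma eq_NAE_conj (U : finType) (V : eqType) (A : seq {set U})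
    (x y : U -> V) : x =1 y -> NAE_conj A x = NAE_conj A y.
Proof.
move=> xy; apply: eq_all => S; congr (~~ _).
by apply: eq_forallb => i; congr (_ ==> _); apply: eq_forallb => j; rewrite !xy.
Qed.

(** If [x] is constant on a hyperedge, then so is [f \o x]. *)
Lemma NAE_conj_comp (U : finType) (V W : eqType) (A : seq {set U})
    (f : V -> W) (x : U -> V) : NAE_conj A (f \o x) -> NAE_conj A x.
Proof.
apply: sub_all => S; apply: contra => /forall_inP xS.
apply/forall_inP => i Si; apply/forall_inP => j Sj /=.
by rewrite (eqP (forall_inP (xS i Si) j Sj)).
Qed.

(** Taking a bare map [x] into ['I_N] keeps the dependent type of assignments out of the argument;
    it is applied to [values x]. *)
Lemma NAE_conjE (U : finType) (A : seq {set U}) (N c : nat)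
    (F : {set {ffun 'I_N -> 'I_c}})
    (hF : forall h : {ffun U -> 'I_N}, proper_coloring A h ->
          exists2 f : {ffun 'I_N -> 'I_c}, f \in F &
            proper_coloring A [ffun u => f (h u)])
    (x : U -> 'I_N) :
  NAE_conj A x =
  [exists g : {ffun U -> 'I_c}, proper_coloring A g &&
     [exists f in F, [forall i : U, f (x i) == g i]]].
Proof.
apply/idP/existsP => [xA | [g /andP[gA /exists_inP[f _ /forallP fg]]]].
  have /hF[f Ff fA] : proper_coloring A (finfun x).
    by rewrite proper_coloringE (eq_NAE_conj _ _ _ _ _ (ffunE x)).
  exists [ffun u => f (finfun x u)]; rewrite fA.
  by apply/exists_inP; exists f => //; apply/forallP => i; rewrite !ffunE.
apply: (NAE_conj_comp _ _ _ _ f); move: gA; rewrite proper_coloringE.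
by rewrite (eq_NAE_conj _ _ _ g (f \o x)) // => i; rewrite /= (eqP (fg i)).
Qed.

Theorem lemma5p1 (U : finType) (A : seq {set U}) (N c : nat)
    (D : U -> {set 'I_N}) (F : {set {ffun 'I_N -> 'I_c}})
    (hA : forall S : {set U}, S \in A -> 1 < #|S|)
    (hc : 0 < c)
    (hF : forall h : {ffun U -> 'I_N}, proper_coloring A h ->
          exists2 f : {ffun 'I_N -> 'I_c}, f \in F &
            proper_coloring A [ffun u => f (h u)]) :
  (forall x : assignment (domain D),
     NAE_conj A (values x) =
     [exists g : {ffun U -> 'I_c}, proper_coloring A g &&
        [exists f in F, [forall i : U, f (values x i) == g i]]]) /\
  boolean_tensor_rank (fun x : assignment (domain D) => NAE_conj A (values x))
    <= num_proper_colorings A c * #|F|.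
Proof.
split=> [x|]; first exact: NAE_conjE.
(* The terms are indexed by the pairs [p = (g, f)] of a set product; for fixed [p] the factor at [i]
   depends on the value [v] alone. *)
rewrite /num_proper_colorings -cardsX.
apply: (boolean_tensor_rank_le_card _ _ _ _ _
  (fun (p : {ffun U -> 'I_c} * {ffun 'I_N -> 'I_c}) i (v : domain D i) =>
     p.2 (val v) == p.1 i)) => x.
rewrite (NAE_conjE _ _ _ _ _ hF).
apply/existsP/exists_inP => [[g /andP[gA /exists_inP[f Ff fg]]] | [[g f]]].
  by exists (g, f); rewrite // inE /= inE gA.
rewrite inE /= inE => /andP[gA Ff] fg; exists g; rewrite gA.
by apply/exists_inP; exists f.
Qed.
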